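(* Let a representation of the Weyl algebra on a complex vector space be given in which $X$ acts invertibly. For $n\in\mathbb N_0$, $k\in\mathbb Z$ put $$H_{nk}=XCD+(k+1)D+n,\qquad U_{nk}=\ker H_{nk}\cap\ker D^{n+1}.$$ Then the Laguerre grid, with vertex spaces $U_{nk}$ ($n\in\mathbb N_0,\ k\in\mathbb Z$) and arrows (present whenever both end vertices have first index $\ge 0$) - East: $k+XC:\ U_{nk}\to U_{n+1,k-1}$, - West: $-D:\ U_{nk}\to U_{n-1,k+1}$, - North: $-C:\ U_{nk}\to U_{n,k+1}$, - South: $\mathcal D_n:\ U_{nk}\to U_{n,k-1}$, - Northeast: $n+k+1+XC:\ U_{nk}\to U_{n+1,k}$, - Southwest: $n-XD:\ U_{nk}\to U_{n-1,k}$, - Southeast: $(k-1)\mathcal D_n-X:\ U_{nk}\to U_{n+1,k-2}$, - Northwest: $DC:\ U_{nk}\to U_{n-1,k+2}$, is a well defined SIE grid: each listed operator maps the stated source space into the stated target space, and every circuit endomorphism of the grid is a scalar multiple of the identity. Moreover the following circuit endomorphisms $U_{nk}\to U_{nk}$ act as the stated scalars (for those circuits all of whose vertices have first index $\ge0$). Narrow circuits: - East: $(-D)(k+XC)=n+1$; - West: $(k+1+XC)(-D)=n$; - North: $\mathcal D_n(-C)=1$; - South: $(-C)\mathcal D_n=1$; - Northeast: $(n+1-XD)(n+1+k+XC)=(n+1)(n+k+1)$; - Southwest: $(n+k+XC)(n-XD)=n(n+k)$; - Northwest: $[(k+1)\mathcal D_{n-1}-X]\,DC=n$; - Southeast: $DC\,[(k-1)\mathcal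 D_n-X]=n+1$. Triangle circuits: - East–Northeast: $(n+1-XD)(-C)(k+XC)=(n+1)(n+k+1)$; - Northeast–East: $(-D)\mathcal D_{n+1}(n+k+1+XC)=n+1$; - Northeast–North: $\mathcal D_n(-D)(n+k+1+XC)=n+1$; - North–Northeast: $(n+1-XD)(k+1+XC)(-C)=(n+1)(n+k+1)$; - North–Northwest: $[(k+1)\mathcal D_{n-1}-X](-D)(-C)=n$; - Northwest–North: $\mathcal D_n(k+2+XC)DC=n$; - Northwest–West: $(k+1+XC)\mathcal D_{n-1}DC=n$; - West–Northwest: $[(k+1)\mathcal D_{n-1}-X](-C)(-D)=n$. Square circuits: - counterclockwise: $\mathcal D_n(-D)(-C)(k+XC)=n+1$; - clockwise: $(-D)\mathcal D_{n+1}(k+1+XC)(-C)=n+1$.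
   Context: The Weyl algebra is the associative unital $\mathbb C$-algebra generated by $D,X$ with relation $DX-XD=1$ (standard representation: $D$ is differentiation and $X$ multiplication by the variable on smooth functions). In it set $C=D-1$ and $\mathcal D_n=1+D+D^2+\dots+D^n$. Standing assumption: $X$ is invertible (adjoin $X^{-1}$ to the algebra, or restrict functions e.g. to $(0,\infty)$). Kernels are taken in the given representation space. A grid here is a diagram of vector spaces indexed by vertices, with operators along arrows; a circuit is a closed path of composable arrows starting and ending at the same vertex, and its circuit endomorphism is the composition of the operators along it (rightmost first). A representation is called SIE (scalar intrinsic endomorphisms) if every circuit endomorphism is a scalar multiple of the identity of the corresponding vertex space. A scalar multiple of the identity is identified with the scalar; all displayed identities are identities of operators restricted to $U_{nk}$. *)

(* Defs.v *)
(* MathComp *)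
From HB Require Import structures.
From mathcomp Require Import all_boot all_order all_algebra.
From mathcomp Require Import complex reals.

Set Implicit Arguments.
Unset Strict Implicit.
Unset Printing Implicit Defensive.

Import Order.TTheory GRing.Theory Num.Theory.
Local Open Scope ring_scope.

Record grid (K : fieldType) := Grid {
  vertex : Type;
  vertex_space : vertex -> lmodType K;
  arrow : vertex -> vertex -> Type;
  arrow_map : forall u v,
    arrow u v -> {linear vertex_space u -> vertex_space v}
}.
Arguments arrow_map {K} g {u v}.

Inductive walk (K : fieldType) (G : grid K) : vertex G -> vertex G -> Type :=
| PNil u : walk u u
| PCons u v w of arrow u v & walk v w : walk u w.

Fixpoint walk_map (K : fieldType) (G : grid K) (u w : vertex G)
    (p : walk u w) : vertex_space u -> vertex_space w :=
  match p in walk u w return vertex_space u -> vertex_space w with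
  | PNil _ => id
  | PCons _ _ _ a q => walk_map q \o arrow_map G a
  end.

Definition SIE (K : fieldType) (G : grid K) : Prop :=
  forall (u : vertex G) (p : walk u u),
    exists c : K, forall x : vertex_space u, walk_map p x = c *: x.

Definition acts_as (K : fieldType) (V : lmodType K) (U : {pred V})
    (A : V -> V) (c : K) : Prop :=
  forall v, v \in U -> A v = c *: v.

Section Operators.
Variables (K : fieldType) (V : lmodType K) (D X : {linear V -> V}).
Implicit Types (n : nat) (k : int).

Definition opC : V -> V := D \- idfun.
Fact opC_is_linear : linear opC.
Proof. by move=> a u v; rewrite /opC linearP. Qed.
HB.instance Definition _ :=
  GRing.isLinear.Build K V V _ opC opC_is_linear.

Definition Dpow n : V -> V := iter n D.

Fact Dpow_is_linear n : linear (Dpow n).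
Proof. by move=> a u v; elim: n => //= n ->; rewrite linearP. Qed.
HB.instance Definition _ n :=
  GRing.isLinear.Build K V V _ (Dpow n) (Dpow_is_linear n).
Arguments Dpow n v : simpl never.

Definition Dsum n : V -> V := fun v => \sum_(i < n.+1) Dpow i v.

Fact Dsum_is_linear n : linear (Dsum n).
Proof.
move=> a u v; rewrite /Dsum scaler_sumr -big_split /=.
by apply: eq_bigr => i _; rewrite linearP.
Qed.
HB.instance Definition _ n :=
  GRing.isLinear.Build K V V _ (Dsum n) (Dsum_is_linear n).

Definition addXC k : V -> V := (k%:~R \*: idfun) \+ (X \o opC).
Fact addXC_is_linear k : linear (addXC k).
Proof. by move=> a u v; rewrite /addXC linearP. Qed.
HB.instance Definition _ k :=
  GRing.isLinear.Build K V V _ (addXC k) (addXC_is_linear k).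

Definition subXD n : V -> V := (n%:R \*: idfun) \- (X \o D).
Fact subXD_is_linear n : linear (subXD n).
Proof. by move=> a u v; rewrite /subXD linearP. Qed.
HB.instance Definition _ n :=
  GRing.isLinear.Build K V V _ (subXD n) (subXD_is_linear n).

Definition DsumX n k : V -> V := (k%:~R \*: Dsum n) \- X.
Fact DsumX_is_linear n k : linear (DsumX n k).
Proof. by move=> a u v; rewrite /DsumX linearP. Qed.
HB.instance Definition _ n k :=
  GRing.isLinear.Build K V V _ (DsumX n k) (DsumX_is_linear n k).

Definition opH n k : V -> V :=
  (X \o opC \o D) \+ ((k + 1)%:~R \*: D) \+ (n%:R \*: idfun).
Fact opH_is_linear n k : linear (opH n k).
Proof. by move=> a u v; rewrite /opH linearP. Qed.
HB.instance Definition _ n k :=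
  GRing.isLinear.Build K V V _ (opH n k) (opH_is_linear n k).

Definition U n k : {pred V} :=
  [pred v | (opH n k v == 0) && (Dpow n.+1 v == 0)].

Fact U_submod_closed n k : subsemimod_closed (U n k).
Proof.
split; first split; first by rewrite inE !linear0 eqxx.
- move=> u v; rewrite !inE => /andP[/eqP hu /eqP du] /andP[/eqP hv /eqP dv].
  by rewrite !linearD /= hu du hv dv !addr0 eqxx.
- move=> a v; rewrite !inE => /andP[/eqP hv /eqP dv].
  by rewrite !linearZ_LR /= hv dv !scaler0 eqxx.
Qed.
HB.instance Definition _ n k :=
  GRing.isSubmodClosed.Build K V (U n k) (U_submod_closed n k).

Record Uspace n k := InU { Uval : V; _ : Uval \in U n k }.
HB.instance Definition _ n k := [isSub for @Uval n k].
HB.instance Definition _ n k := [Choice of Uspace n k by <:].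
HB.instance Definition _ n k := [SubChoice_isSubLmodule of Uspace n k by <:].

Variant direction :=
  East | West | North | South | Northeast | Southwest | Southeast | Northwest.

Definition displacement (d : direction) : int * int :=
  match d with
  | East => (1, -1)
  | West => (-1, 1)
  | North => (0, 1)
  | South => (0, -1)
  | Northeast => (1, 0)
  | Southwest => (-1, 0)
  | Southeast => (1, -2)
  | Northwest => (-1, 2)
  end.

(* The target is compared with the source in int * int, so that there is no
   arrow whose target would have a negative first index. *)
Definition leads_to (d : direction) (s t : nat * int) : bool :=
  (t.1%:Z == s.1%:Z + (displacement d).1) && (t.2 == s.2 + (displacement d).2).

Definition laguerre_op (d : direction) n k : V -> V :=
  match d with
  | East => addXC k
  | West => \- D
  | North => \- opC
  | South => Dsum n
  | Northeast => addXC (n%:Z + k + 1)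
  | Southwest => subXD n
  | Southeast => DsumX n (k - 1)
  | Northwest => D \o opC
  end.

Fact laguerre_op_is_linear d n k : linear (laguerre_op d n k).
Proof. by case: d => a u v; exact: linearP. Qed.
HB.instance Definition _ d n k :=
  GRing.isLinear.Build K V V _ (laguerre_op d n k)
    (laguerre_op_is_linear d n k).

Definition laguerre_well_defined : Prop :=
  forall (d : direction) (s t : nat * int), leads_to d s t ->
  forall v, v \in U s.1 s.2 -> laguerre_op d s.1 s.2 v \in U t.1 t.2.

Section LaguerreGrid.
Hypothesis wd : laguerre_well_defined.

Section Arrow.
Variables (s t : nat * int) (a : {d : direction | leads_to d s t}).

Definition laguerre_map (x : Uspace s.1 s.2) : Uspace t.1 t.2 :=
  InU (wd (valP a) (valP x)).

Fact laguerre_map_is_linear : linear laguerre_map.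
Proof. by move=> c x y; apply: val_inj; rewrite /= !linearP. Qed.
HB.instance Definition _ :=
  GRing.isLinear.Build K (Uspace s.1 s.2) (Uspace t.1 t.2) _ laguerre_map
    laguerre_map_is_linear.
End Arrow.

Definition laguerre_grid : grid K :=
  @Grid K (nat * int) (fun s => Uspace s.1 s.2 : lmodType K)
    (fun s t => {d : direction | leads_to d s t})
    (fun s t a => @laguerre_map s t a).
End LaguerreGrid.

End Operators.

(* Main.v *)
(* Every operator of the grid intertwines, up to a scalar depending only on the
   arrow, the maps D^n on the spaces U_{nk}: for v in U_{nk} the relation
   (k + 1 + XC)(-D)v = n v shows by induction on n that D^n v = 0 forces v = 0,
   and for instance D^n (-C v) = D^n v because D^(n+1) v = 0, while
   D^(n+1) (k + XC)v = -(n+1) D^n v.  Along a circuit the scalars multiply, and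
   injectivity of D^n on U_{nk} turns the product into the circuit
   endomorphism. *)
Require Import Defs.
From mathcomp Require Import all_boot all_order all_algebra.
From mathcomp Require Import complex reals.
From mathcomp Require Import zify ring.

Set Implicit Arguments.
Unset Strict Implicit.
Unset Printing Implicit Defensive.

Import Order.TTheory GRing.Theory Num.Theory.
Local Open Scope ring_scope.
Local Open Scope complex_scope.

Arguments Dpow {K V} D n v : simpl never.

Section WeylRelations.
Context (K : numFieldType) (V : lmodType K) (D X : {linear V -> V}).
Context (weylDX : forall v : V, D (X v) - X (D v) = v).
Implicit Types (n m : nat) (k l : int) (u v w : V).

(** * Commutation relations between [D], [X] and [C] *)

Lemma D_X v : D (X v) = X (D v) + v.
Proof. by rewrite -{3}(weylDX v) addrC subrK. Qed.

Lemma opCE v : opC D v = D v - v.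
Proof. by []. Qed.

Lemma addXCE k v : addXC D X k v = k%:~R *: v + X (opC D v).
Proof. by []. Qed.

Lemma opC_D v : opC D (D v) = D (opC D v).
Proof. by rewrite !opCE linearB. Qed.

Lemma opC_X v : opC D (X v) = X (opC D v) + v.
Proof. by rewrite !opCE D_X linearB addrAC. Qed.

Lemma addXCD k l v : addXC D X (k + l) v = k%:~R *: v + addXC D X l v.
Proof. by rewrite !addXCE intrD scalerDl addrA. Qed.

(** Moving [D] across [XC] costs [C = D - 1]: the part [D] raises the index by one, the part [-1]
    remains as [- v]. *)
Lemma D_addXC k v : D (addXC D X k v) = addXC D X (k + 1) (D v) - v.
Proof.
rewrite !addXCE linearD linearZ /= D_X opC_D intrD scalerDl scale1r -!addrA.
by congr (_ + _); rewrite [in LHS]addrC -addrA [- v + _]addrC.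
Qed.

(** Since [[C, X] = 1], moving [C] across [XC] costs one further [C], which the index absorbs
    entirely. *)
Lemma opC_addXC k v : opC D (addXC D X k v) = addXC D X (k + 1) (opC D v).
Proof.
rewrite addXCE linearD linearZ /= opC_X addXCE intrD scalerDl scale1r.
by rewrite -addrA [in LHS]addrA; rewrite addrAC -!addrA.
Qed.

(** * Powers of [D] and truncated geometric sums *)

Lemma DpowS n v : Dpow D n.+1 v = D (Dpow D n v).
Proof. by []. Qed.

Lemma DpowSr n v : Dpow D n.+1 v = Dpow D n (D v).
Proof. by rewrite /Dpow iterSr. Qed.

Lemma Dpow_comm (A : {linear V -> V}) n v :
  (forall u, D (A u) = A (D u)) -> Dpow D n (A v) = A (Dpow D n v).
Proof. by move=> AD; elim: n => // n IH; rewrite !DpowS IH AD. Qed.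

Lemma Dpow_opC n v : Dpow D n (opC D v) = opC D (Dpow D n v).
Proof. by apply: (@Dpow_comm (opC D)) => u; rewrite /= opC_D. Qed.

Lemma D_Dsum n v : D (Dsum D n v) = Dsum D n (D v).
Proof.
rewrite /Dsum linear_sum; apply: eq_bigr => i _ /=.
by rewrite -DpowS DpowSr.
Qed.

(** Telescoping geometric sum. On the kernel of [D^(n+1)] it makes [Dsum D n] an inverse of [-C]. *)
Lemma Dsum_opC n v : Dsum D n (opC D v) = Dpow D n.+1 v - v.
Proof.
rewrite -[X in _ = _ - X]/(Dpow D 0 v) -(telescope_sumr (fun i => Dpow D i v)) //.
rewrite big_mkord.
by apply: eq_bigr => i _; rewrite opCE linearB /= -DpowSr.
Qed.

Lemma opC_Dsum n v : opC D (Dsum D n v) = Dpow D n.+1 v - v.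
Proof. by rewrite opCE D_Dsum -linearB /= Dsum_opC. Qed.

(** On the kernel of a power of [D], [C = D - 1] is a unipotent perturbation of [-1]; an equation
    there may thus be checked after applying [C]. *)
Lemma opC_inj n v : Dpow D n v = 0 -> opC D v = 0 -> v = 0.
Proof.
move=> Dnv Cv0; have := Dsum_opC n v.
by rewrite Cv0 linear0 DpowS Dnv linear0 sub0r => /esym/eqP; rewrite oppr_eq0 => /eqP.
Qed.

Lemma Dpow_addXC n k v :
  Dpow D n.+1 (addXC D X k v) =
  addXC D X (k + n.+1%:Z) (Dpow D n.+1 v) - n.+1%:R *: Dpow D n v.
Proof.
elim: n => [|n IH]; first by rewrite scale1r; exact: D_addXC.
rewrite DpowS IH linearB linearZ /= D_addXC -!DpowS -addrA -opprD.
rewrite (mulrS _ n.+1) scalerDl scale1r.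
by congr (addXC _ _ _ _ - _); lia.
Qed.

Lemma Dpow_X n v : Dpow D n (X v) = X (Dpow D n v) + n%:R *: Dpow D n.-1 v.
Proof.
elim: n => [|n IH]; first by rewrite scale0r addr0.
rewrite DpowS IH linearD linearZ /= D_X -addrA; congr (_ + _).
(* The truncated [n.-1] at [n = 0] is harmless, its coefficient being zero. *)
case: n {IH} => [|n]; first by rewrite scale0r addr0 scale1r.
by rewrite -DpowS -[X in X + _]scale1r -scalerDl -mulrS.
Qed.

(** * The spaces [U] and maps between them compatible with powers of [D] *)

Lemma opHE n k v : opH D X n k v = addXC D X (k + 1) (D v) + n%:R *: v.
Proof. by rewrite addXCE [X in _ = X + _]addrC. Qed.

Lemma UP n k v :
  reflect (addXC D X (k + 1) (D v) = - (n%:R *: v) /\ Dpow D n.+1 v = 0)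
          (v \in U D X n k).
Proof.
rewrite inE opHE addr_eq0.
by apply: (iffP andP) => [[/eqP ? /eqP ?]|[-> ->]]; rewrite ?eqxx.
Qed.

(** Membership in the target and the scalar are bundled, so that both pass to composites at once. *)
Definition intertwines n k m l (A : V -> V) (c : K) : Prop :=
  {in U D X n k, forall v, A v \in U D X m l /\ Dpow D m (A v) = c *: Dpow D n v}.

Lemma intertwines_comp n k m l p q A B c d :
  intertwines n k m l A c -> intertwines m l p q B d ->
  intertwines n k p q (B \o A) (d * c).
Proof.
move=> hA hB v /hA[/hB[UBA eqB] eqA].
by split=> //; rewrite [LHS]eqB eqA scalerA.
Qed.

Lemma eq_intertwines n k m l A B c :
  {in U D X n k, A =1 B} -> intertwines n k m l A c -> intertwines n k m l B c.
Proof. by move=> eqAB hA v Uv; rewrite -eqAB //; exact: hA. Qed.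

Lemma intertwines_west n k : intertwines n.+1 k n (k + 1) (\- D) (-1).
Proof.
move=> v /UP[Hv Dv0]; split; last by rewrite /= linearN /= -DpowSr scaleN1r.
apply/UP; split; last by rewrite /= linearN /= -DpowSr Dv0 oppr0.
(* Applying [D] to the equation of [v] produces an extra [- D v], whose cancellation lowers [n.+1]
   to [n]. *)
have /= := D_addXC (k + 1) (D v).
rewrite Hv !linearN linearZ /= mulrS scalerDl scale1r opprD addrC.
by move=> /addIr <-.
Qed.

(** The induction follows the west arrow, so [k] varies. Once [D v = 0], the equation of [v] leaves
    [n.+1%:R *: v = 0], and the characteristic is zero. *)
Lemma U_Dpow_eq0 n k : {in U D X n k, forall v, Dpow D n v = 0 -> v = 0}.
Proof.
elim: n k => [k v _ //|n IH k v Uv]; rewrite DpowSr => DDv0.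
have [UDv _] := intertwines_west Uv.
have Dv0 : D v = 0.
  apply/eqP; rewrite -oppr_eq0; apply/eqP/(IH _ _ UDv).
  by rewrite /= linearN /= DDv0 oppr0.
have /UP[/eqP + _] := Uv.
by rewrite Dv0 linear0 eq_sym oppr_eq0 scaler_eq0 pnatr_eq0 => /eqP.
Qed.

Lemma U_Dpow_inj n k : {in U D X n k &, injective (Dpow D n)}.
Proof.
move=> u v Uu Uv eq_uv; apply/eqP; rewrite -subr_eq0 -scaleN1r; apply/eqP.
apply: (@U_Dpow_eq0 n k); first by rewrite rpredD ?rpredZ.
by rewrite linearD linearZ /= eq_uv scaleN1r subrr.
Qed.

Lemma intertwines_acts_as n k A c :
  intertwines n k n k A c -> acts_as (U D X n k) A c.
Proof.
move=> hA v Uv; have [UAv eqA] := hA v Uv.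
by apply: (@U_Dpow_inj n k); rewrite ?rpredZ // eqA linearZ.
Qed.

(** * The remaining seven arrows *)

Lemma intertwines_north n k : intertwines n k n (k + 1) (\- opC D) 1.
Proof.
move=> v /UP[Hv Dv0]; split; last first.
  by rewrite /= linearN /= Dpow_opC opCE -DpowS Dv0 sub0r opprK scale1r.
apply/UP; split; last by rewrite /= linearN /= Dpow_opC Dv0 linear0 oppr0.
by rewrite /= !linearN /= -opC_D -opC_addXC Hv linearN linearZ.
Qed.

Lemma Dpow_Dsum n m v : Dpow D m (Dsum D n v) = Dsum D n (Dpow D m v).
Proof. by apply: (@Dpow_comm (Dsum D n)) => u; rewrite /= D_Dsum. Qed.

Lemma Dsum_eq n v : D v = 0 -> Dsum D n v = v.
Proof.
move=> Dv0; rewrite /Dsum big_ord_recl /= big1 ?addr0 // => i _.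
by rewrite DpowSr Dv0 linear0.
Qed.

Lemma intertwines_south n k : intertwines n k n (k - 1) (Dsum D n) 1.
Proof.
move=> v /UP[Hv Dv0]; split; last by rewrite Dpow_Dsum Dsum_eq ?scale1r.
have DSv0 : Dpow D n.+1 (Dsum D n v) = 0 by rewrite Dpow_Dsum Dv0 linear0.
apply/UP; split => //; apply/eqP; rewrite -addr_eq0; apply/eqP.
(* The defect of the target equation is killed by [D^(n+1)]; applying [C] turns [Dsum D n v] into
   [- v] and gives back the equation of [v]. *)
rewrite subrK; apply: (@opC_inj n.+1).
  rewrite linearD linearZ /= DSv0 scaler0 addr0 Dpow_addXC -!DpowSr.
  by rewrite (DpowS n.+1) DSv0 !linear0 addr0.
rewrite linearD linearZ /= opC_addXC opC_D opC_Dsum Dv0 sub0r !linearN /= Hv.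
by rewrite opprK subrr.
Qed.

Lemma intertwines_east n k :
  intertwines n k n.+1 (k - 1) (addXC D X k) (- n.+1%:R).
Proof.
move=> v /UP[Hv Dv0].
(* This identity yields the target equation, the vanishing of [D^(n+2)] and the factor. *)
have DE : D (addXC D X k v) = - (n.+1%:R *: v).
  by rewrite D_addXC Hv -opprD mulrSr scalerDl scale1r.
split; last by rewrite DpowSr DE linearN linearZ /= scaleNr.
apply/UP; rewrite subrK DpowSr !DE !linearN !linearZ /= Dv0.
by rewrite oppr0 scaler0.
Qed.

(** With [C v = D v - v], the equation of [v] replaces the [D v] term by [- n v]. Hence Northeast is
    East followed by North. *)
Lemma opC_addXC_U n k :
  {in U D X n k, forall v, opC D (addXC D X k v) = - addXC D X (n%:Z + k + 1) v}.
Proof.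
move=> v /UP[Hv _]; rewrite opC_addXC opCE linearB /= Hv.
by rewrite -(addrA n%:Z) (addXCD n%:Z) [RHS]opprD.
Qed.

Lemma intertwines_northeast n k :
  intertwines n k n.+1 k (addXC D X (n%:Z + k + 1)) (- n.+1%:R).
Proof.
have := intertwines_comp (@intertwines_east n k) (@intertwines_north n.+1 (k - 1)).
rewrite mul1r subrK; apply: eq_intertwines => v Uv /=.
by rewrite (opC_addXC_U Uv) opprK.
Qed.

Lemma intertwines_southwest n k :
  intertwines n.+1 k n k (subXD D X n.+1) (- (n.+1%:Z + k)%:~R).
Proof.
have h := intertwines_comp (@intertwines_west n k) (@intertwines_south n (k + 1)).
rewrite addrK mul1r in h.
(* Southwest is West followed by South, times [n + 1 + k], which may vanish. *)
have eqS : {in U D X n.+1 k, forall v,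
    subXD D X n.+1 v = (n.+1%:Z + k)%:~R *: Dsum D n (- D v)}.
  move=> v /UP[Hv Dv0].
  (* The commutator term of [D^(n+1) X] cancels [n.+1%:R], leaving [- X D^(n+2) v = 0]. *)
  have D0 : Dpow D n.+1 (subXD D X n.+1 v) = 0.
    rewrite linearB linearZ /= Dpow_X -DpowSr Dv0 linear0 add0r.
    by rewrite -DpowSr subrr.
  have CS : opC D (subXD D X n.+1 v) = (n.+1%:Z + k)%:~R *: D v.
    have XCD : X (opC D (D v)) = - (n.+1%:R *: v) - (k + 1)%:~R *: D v.
      by rewrite -Hv addXCE addrAC subrr add0r.
    rewrite linearB linearZ /= opC_X XCD opCE scalerBr !opprD !opprK !addrA subrK.
    by rewrite [(k + 1)%:~R]intrD scalerDl scale1r addrA addrK [in RHS]intrD scalerDl.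
  (* As [D^(n+1)] kills [subXD D X n.+1 v], the vector is recovered from its image under [C]. *)
  have := Dsum_opC n (subXD D X n.+1 v).
  by rewrite D0 sub0r CS linearZ linearN /= scalerN => ->; rewrite opprK.
move=> v Uv; have [US eqD] := h v Uv.
rewrite eqS //; split; first by rewrite rpredZ.
by rewrite linearZ /= [Dpow _ _ _]eqD scalerA mulrN1.
Qed.

(** South followed by East: [C] undoes [Dsum D n] up to sign, which leaves [- X]. *)
Lemma intertwines_southeast n k :
  intertwines n k n.+1 (k - 2) (DsumX D X n (k - 1)) (- n.+1%:R).
Proof.
have := intertwines_comp (@intertwines_south n k) (@intertwines_east n (k - 1)).
rewrite mulr1 -addrA -opprD; apply: eq_intertwines => v /UP[_ Dv0].
by rewrite /= addXCE opC_Dsum Dv0 sub0r linearN.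
Qed.

Lemma intertwines_northwest n k : intertwines n.+1 k n (k + 2) (D \o opC D) (-1).
Proof.
have := intertwines_comp (@intertwines_north n.+1 k) (@intertwines_west n (k + 1)).
rewrite mulr1 -addrA; apply: eq_intertwines => v _ /=.
by rewrite linearN opprK.
Qed.

(** * Scalars of arrows and walks in the grid *)

Definition laguerre_factor d n k : K :=
  match d with
  | East | Northeast | Southeast => - n.+1%:R
  | West | Northwest => -1
  | North | South => 1
  | Southwest => - (n%:Z + k)%:~R
  end.

(** Westward arrows leave only from a positive first index, so their factors at [n = 0] never
    enter. *)
Lemma intertwines_arrow d n k m l : leads_to d (n, k) (m, l) ->
  intertwines n k m l (laguerre_op D X d n k) (laguerre_factor d n k).
Proof.
rewrite /leads_to; case: d => /= /andP[/eqP eqm /eqP ->].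
- have -> : m = n.+1 by lia.
  exact: intertwines_east.
- have -> : n = m.+1 by lia.
  exact: intertwines_west.
- have -> : m = n by lia.
  exact: intertwines_north.
- have -> : m = n by lia.
  exact: intertwines_south.
- have -> : m = n.+1 by lia.
  rewrite addr0; exact: intertwines_northeast.
- have -> : n = m.+1 by lia.
  rewrite addr0; exact: intertwines_southwest.
- have -> : m = n.+1 by lia.
  exact: intertwines_southeast.
- have -> : n = m.+1 by lia.
  exact: intertwines_northwest.
Qed.

Lemma laguerre_wd : laguerre_well_defined D X.
Proof.
by move=> d [n k] [m l] dst v Uv; have [] := intertwines_arrow dst Uv.
Qed.

(** Stated for walks with arbitrary ends, since the tail of a circuit is not a circuit. *)
Lemma laguerre_walk_factor (s t : nat * int) (p : @walk _ (laguerre_grid laguerre_wd) s t) :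
  exists c : K, forall x : Uspace D X s.1 s.2,
    Dpow D t.1 (val (walk_map p x : Uspace D X t.1 t.2)) = c *: Dpow D s.1 (val x).
Proof.
elim: p => [u|u v w [d duv] q [c IH]]; first by exists 1 => x; rewrite scale1r.
exists (c * laguerre_factor d u.1 u.2) => x /=.
rewrite IH /=.
case: u v duv {q IH} x => [n k] [m l] duv x.
by have [_ ->] := intertwines_arrow duv (valP x); rewrite scalerA.
Qed.

Lemma laguerre_SIE : SIE (laguerre_grid laguerre_wd).
Proof.
move=> u p; have [c pE] := laguerre_walk_factor p; exists c => x.
apply/val_inj/(@U_Dpow_inj u.1 u.2); [exact: valP | exact: valP |].
by rewrite pE -[RHS]/(Dpow D u.1 (c *: val x)) linearZ.
Qed.

End WeylRelations.

(** * Explicit scalars of the listed circuits *)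

Ltac solve_circuit := rewrite /leads_to /=; (lia || ring).

Theorem theorem4 (R : realType) (V : lmodType R[i]) (D X : {linear V -> V})
    (weylDX : forall v : V, D (X v) - X (D v) = v) (Xinv : bijective X) :
  (exists wd : laguerre_well_defined D X, SIE (laguerre_grid wd)) /\
  (forall (n : nat) (k : int),
    [/\ (* narrow circuits *)
      [/\ acts_as (U D X n k) ((\- D) \o addXC D X k) n.+1%:R,
          (0 < n)%N ->
            acts_as (U D X n k) (addXC D X (k + 1) \o (\- D)) n%:R,
          acts_as (U D X n k) (Dsum D n \o (\- opC D)) 1 &
          acts_as (U D X n k) ((\- opC D) \o Dsum D n) 1],
      [/\ acts_as (U D X n k)
            (subXD D X n.+1 \o addXC D X (n%:Z + 1 + k))
            (n.+1%:R * (n%:Z + k + 1)%:~R),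
          (0 < n)%N ->
            acts_as (U D X n k) (addXC D X (n%:Z + k) \o subXD D X n)
              (n%:R * (n%:Z + k)%:~R),
          (0 < n)%N ->
            acts_as (U D X n k) (DsumX D X n.-1 (k + 1) \o (D \o opC D)) n%:R &
          acts_as (U D X n k) ((D \o opC D) \o DsumX D X n (k - 1)) n.+1%:R],
      (* triangle circuits *)
      [/\ acts_as (U D X n k)
            (subXD D X n.+1 \o (\- opC D) \o addXC D X k)
            (n.+1%:R * (n%:Z + k + 1)%:~R),
          acts_as (U D X n k)
            ((\- D) \o Dsum D n.+1 \o addXC D X (n%:Z + k + 1)) n.+1%:R,
          acts_as (U D X n k)
            (Dsum D n \o (\- D) \o addXC D X (n%:Z + k + 1)) n.+1%:R &
          acts_as (U D X n k)
            (subXD D X n.+1 \o addXC D X (k + 1) \o (\- opC D))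
            (n.+1%:R * (n%:Z + k + 1)%:~R)],
      (0 < n)%N ->
      [/\ acts_as (U D X n k)
            (DsumX D X n.-1 (k + 1) \o (\- D) \o (\- opC D)) n%:R,
          acts_as (U D X n k)
            (Dsum D n \o addXC D X (k + 2) \o (D \o opC D)) n%:R,
          acts_as (U D X n k)
            (addXC D X (k + 1) \o Dsum D n.-1 \o (D \o opC D)) n%:R &
          acts_as (U D X n k)
            (DsumX D X n.-1 (k + 1) \o (\- opC D) \o (\- D)) n%:R] &
      (* square circuits *)
      acts_as (U D X n k)
        (Dsum D n \o (\- D) \o (\- opC D) \o addXC D X k) n.+1%:R /\
      acts_as (U D X n k)
        ((\- D) \o Dsum D n.+1 \o addXC D X (k + 1) \o (\- opC D)) n.+1%:R]).
Proof.
split; first by exists (laguerre_wd weylDX); exact: laguerre_SIE.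
have arrow d n k m l := @intertwines_arrow _ _ _ _ weylDX d n k m l.
(* Here [c'] is the product of factors read off from the arrows; its equality with the stated [c] is
   left to [ring]. *)
have acts n k A c c' : c' = c -> intertwines D X n k n k A c' ->
    acts_as (U D X n k) A c.
  by move=> ->; exact: intertwines_acts_as.
move=> n k.
(* Southeast out of [(n, k + 2)] carries the coefficient [k + 2 - 1], stated as [k + 1]. *)
have k1E : k + 1 = k + 2 - 1 by lia.
split.
- split.
  + by apply: acts _ (intertwines_comp (arrow East n k n.+1 (k - 1) _)
        (arrow West n.+1 (k - 1) n k _)); solve_circuit.
  + case: n => // n _ /=.
    by apply: acts _ (intertwines_comp (arrow West n.+1 k n (k + 1) _)
        (arrow East n (k + 1) n.+1 k _)); solve_circuit.
  + by apply: acts _ (intertwines_comp (arrow North n k n (k + 1) _)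
        (arrow South n (k + 1) n k _)); solve_circuit.
  + by apply: acts _ (intertwines_comp (arrow South n k n (k - 1) _)
        (arrow North n (k - 1) n k _)); solve_circuit.
- split.
  + rewrite addrAC.
    by apply: acts _ (intertwines_comp (arrow Northeast n k n.+1 k _)
        (arrow Southwest n.+1 k n k _)); solve_circuit.
  (* With first index [n.+1], the returning Northeast arrow starts at [n], so its constant must read
     [n + k + 1]. *)
  + case: n => // n _; rewrite intS [1 + _]addrC addrAC.
    by apply: acts _ (intertwines_comp (arrow Southwest n.+1 k n k _)
        (arrow Northeast n k n.+1 k _)); solve_circuit.
  + case: n => // n _ /=; rewrite k1E.
    by apply: acts _ (intertwines_comp (arrow Northwest n.+1 k n (k + 2) _)
        (arrow Southeast n (k + 2) n.+1 k _)); solve_circuit.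
  + by apply: acts _ (intertwines_comp (arrow Southeast n k n.+1 (k - 2) _)
        (arrow Northwest n.+1 (k - 2) n k _)); solve_circuit.
- split.
  + by apply: acts _ (intertwines_comp (intertwines_comp (arrow East n k n.+1 (k - 1) _)
        (arrow North n.+1 (k - 1) n.+1 k _))
        (arrow Southwest n.+1 k n k _)); solve_circuit.
  + by apply: acts _ (intertwines_comp (intertwines_comp (arrow Northeast n k n.+1 k _)
        (arrow South n.+1 k n.+1 (k - 1) _))
        (arrow West n.+1 (k - 1) n k _)); solve_circuit.
  + by apply: acts _ (intertwines_comp (intertwines_comp (arrow Northeast n k n.+1 k _)
        (arrow West n.+1 k n (k + 1) _))
        (arrow South n (k + 1) n k _)); solve_circuit.
  + by apply: acts _ (intertwines_comp (intertwines_comp (arrow North n k n (k + 1) _)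
        (arrow East n (k + 1) n.+1 k _))
        (arrow Southwest n.+1 k n k _)); solve_circuit.
- case: n => // n _; split=> /=.
  + rewrite k1E.
    by apply: acts _ (intertwines_comp (intertwines_comp (arrow North n.+1 k n.+1 (k + 1) _)
        (arrow West n.+1 (k + 1) n (k + 2) _))
        (arrow Southeast n (k + 2) n.+1 k _)); solve_circuit.
  + by apply: acts _ (intertwines_comp (intertwines_comp (arrow Northwest n.+1 k n (k + 2) _)
        (arrow East n (k + 2) n.+1 (k + 1) _))
        (arrow South n.+1 (k + 1) n.+1 k _)); solve_circuit.
  + by apply: acts _ (intertwines_comp (intertwines_comp (arrow Northwest n.+1 k n (k + 2) _)
        (arrow South n (k + 2) n (k + 1) _))
        (arrow East n (k + 1) n.+1 k _)); solve_circuit.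
  + rewrite k1E.
    by apply: acts _ (intertwines_comp (intertwines_comp (arrow West n.+1 k n (k + 1) _)
        (arrow North n (k + 1) n (k + 2) _))
        (arrow Southeast n (k + 2) n.+1 k _)); solve_circuit.
- split.
  + by apply: acts _ (intertwines_comp (intertwines_comp (intertwines_comp (arrow East n k n.+1 (k - 1) _)
        (arrow North n.+1 (k - 1) n.+1 k _))
        (arrow West n.+1 k n (k + 1) _))
        (arrow South n (k + 1) n k _)); solve_circuit.
  + by apply: acts _ (intertwines_comp (intertwines_comp (intertwines_comp (arrow North n k n (k + 1) _)
        (arrow East n (k + 1) n.+1 k _))
        (arrow South n.+1 k n.+1 (k - 1) _))
        (arrow West n.+1 (k - 1) n k _)); solve_circuit.
Qed.
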